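(* Let $(M^3,\varphi,\xi,\eta,g)$ be an almost contact metric manifold of dimension three with Ricci operator $Q$. Suppose that $M$ is weakly $\eta$-Einstein, i.e. there exist smooth functions $\alpha,\beta$ on $M$ such that $\breve R=\alpha g+\beta\,\eta\otimes\eta$. Then, at each point $p\in M$, at least one of the following holds: (i) the Ricci operator has the $\eta$-Einstein form at $p$, i.e. there are real numbers $\overline{\alpha},\overline{\beta}$ such that $Q=\overline{\alpha}I+\overline{\beta}\,\eta\otimes\xi$ on $T_pM$ (that is, $QX=\overline{\alpha}X+\overline{\beta}\,\eta(X)\xi$ for all $X\in T_pM$); (ii) $Q\xi=0$ at $p$; (iii) the metric is weakly Einstein at $p$, i.e. $\breve R=\frac{|R|^2}{3}g$ at $p$.
   Context: All manifolds, vector fields and tensors are smooth. An almost contact metric structure on a smooth manifold $M^{2n+1}$ is a quadruple $(\varphi,\xi,\eta,g)$, where $\varphi$ is a $(1,1)$-tensor field, $\xi$ a vector field, $\eta$ a one-form and $g$ a Riemannian metric such that $\varphi^2=-I+\eta\otimes\xi$, $\eta(\xi)=1$ and $g(\varphi X,\varphi Y)=g(X,Y)-\eta(X)\eta(Y)$ for all vector fields $X,Y$. These imply $\varphi\xi=0$, $\eta\circ\varphi=0$, $\eta(X)=g(X,\xi)$. Curvature convention: $R(X,Y)Z=\nabla_X\nabla_YZ-\nabla_Y\nabla_XZ-\nabla_{[X,Y]}Z$ with $\nabla$ the Levi-Civita connection, $R(X,Y,Z,W)=g(R(X,Y)Z,W)$. The Ricci tensor is $\rho(Y,Z)=\sum_i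 R(e_i,Y,Z,e_i)$ for an orthonormal frame $\{e_i\}$, and the Ricci operator $Q$ is defined by $g(QX,Y)=\rho(X,Y)$. For a Riemannian manifold $(M^m,g)$ the symmetric $(0,2)$-tensor $\breve R$ is $$\breve R(X,Y)=\sum_{i,j,k=1}^m R(X,e_i,e_j,e_k)R(Y,e_i,e_j,e_k),$$ where $\{e_i\}$ is a local orthonormal frame (the definition is independent of the frame), and $|R|^2=\sum_{i,j,k,l}R(e_i,e_j,e_k,e_l)^2$. The condition weakly Einstein is $\breve R=\frac{|R|^2}{m}g$. *)

(* Defs.v *)
From HB Require Import structures.
From mathcomp Require Import all_boot all_order all_algebra.
From mathcomp Require Import all_classical all_reals all_analysis.
From mathcomp Require Import ring.
Set Implicit Arguments.
Unset Strict Implicit.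
Unset Printing Implicit Defensive.
Import Order.TTheory GRing.Theory Num.Theory.
Import numFieldNormedType.Exports.
Local Open Scope classical_set_scope.
Local Open Scope ring_scope.

(* Row-vector convention throughout: tangent vectors are rows, a linear map A
   sends u to [u *m A], a covector is a column, and the chain rule reads
   [v *m 'J f x], as for [jacobian] in the library. *)

Definition partial (R : realType) (n : nat) (k : 'I_n) (f : 'rV[R]_n -> R)
  (x : 'rV[R]_n) : R := 'D_(delta_mx 0 k) f x.

Fixpoint Ck (R : realType) (n : nat) (m : nat) (U : set 'rV[R]_n)
    (f : 'rV[R]_n -> R) : Prop :=
  (forall x, U x -> {for x, continuous f}) /\
  (if m is m'.+1 then
     forall k : 'I_n, (forall x, U x -> derivable f x (delta_mx 0 k)) /\
                      Ck m' U (partial k f)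
   else True).

(* Meaningful for U open. *)
Definition smooth_on (R : realType) (n p q : nat) (U : set 'rV[R]_n)
    (F : 'rV[R]_n -> 'M[R]_(p, q)) : Prop :=
  forall a b m, Ck m U (fun x => F x a b).

Record chart (R : realType) (n : nat) (M : topologicalType) := Chart {
  source : set M;
  target : set 'rV[R]_n;
  coord :> M -> 'rV[R]_n;
  param : 'rV[R]_n -> M;
  source_open : open source;
  target_open : open target;
  coord_target : forall p, source p -> target (coord p);
  param_source : forall x, target x -> source (param x);
  coordK : forall p, source p -> param (coord p) = p;
  paramK : forall x, target x -> coord (param x) = x;
  coord_continuous : forall p, source p -> {for p, continuous coord};
  param_continuous : forall x, target x -> {for x, continuous param} }.

Record smooth_manifold (R : realType) (n : nat) := SmoothManifold {
  points :> topologicalType;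
  points_hausdorff : hausdorff_space points;
  points_second_countable : @second_countable points;
  chart_index : Type;
  atlas : chart_index -> chart R n points;
  atlas_cover : forall p, exists i, source (atlas i) p;
  atlas_smooth : forall i j,
    smooth_on [set x | target (atlas i) x /\
                       source (atlas j) (param (atlas i) x)]
              (atlas j \o param (atlas i)) }.

Definition smooth_function (R : realType) (n : nat) (M : smooth_manifold R n)
    (f : M -> R) : Prop :=
  forall (i : chart_index M) m, Ck m (target (atlas i)) (f \o param (atlas i)).

(* A smooth tensor field is given by its components in every chart, as functions
   of the coordinates. [law J A B] relates the components A in a chart to the
   components B in another one when J is the Jacobian of the coordinate change. *)
Record tensor_field (R : realType) (n : nat) (M : smooth_manifold R n)
    (p q : nat) (law : 'M[R]_n -> 'M[R]_(p, q) -> 'M[R]_(p, q) -> Prop) :=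
  TensorField {
    comp :> chart_index M -> 'rV[R]_n -> 'M[R]_(p, q);
    comp_smooth : forall i, smooth_on (target (atlas i)) (comp i);
    comp_change : forall i j z,
      source (atlas i) z -> source (atlas j) z ->
      law ('J (atlas j \o param (atlas i)) (atlas i z))
          (comp i (atlas i z)) (comp j (atlas j z)) }.

Definition vector_field (R : realType) (n : nat) (M : smooth_manifold R n) :=
  @tensor_field R n M 1 n (fun J X Y => Y = X *m J).

Definition one_form (R : realType) (n : nat) (M : smooth_manifold R n) :=
  @tensor_field R n M n 1 (fun J a b => a = J *m b).

(* (1,1)-tensor fields *)
Definition endo_field (R : realType) (n : nat) (M : smooth_manifold R n) :=
  @tensor_field R n M n n (fun J A B => A *m J = J *m B).

Definition bilinear_field (R : realType) (n : nat) (M : smooth_manifold R n) :=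
  @tensor_field R n M n n (fun J A B => A = J *m B *m J^T).

Identity Coercion tensor_of_bilinear : bilinear_field >-> tensor_field.

Definition pairing (R : realType) (n : nat) (a : 'cV[R]_n) (u : 'rV[R]_n) : R :=
  (u *m a) 0 0.

Definition form (R : realType) (n : nat) (A : 'M[R]_n) (u v : 'rV[R]_n) : R :=
  (u *m A *m v^T) 0 0.

Record riemannian_metric (R : realType) (n : nat) (M : smooth_manifold R n) :=
  RiemannianMetric {
    metric_tensor :> bilinear_field M;
    metric_sym : forall i x, target (atlas i) x ->
      forall u v, form (metric_tensor i x) u v = form (metric_tensor i x) v u;
    metric_pos : forall i x, target (atlas i) x ->
      forall u, u != 0 -> 0 < form (metric_tensor i x) u u }.

(* Existence of such a structure forces the dimension n to be odd. *)
Record almost_contact_metric (R : realType) (n : nat)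
    (M : smooth_manifold R n) := AlmostContactMetric {
  phi : endo_field M;
  xi : vector_field M;
  eta : one_form M;
  metric : riemannian_metric M;
  phi_sq : forall i x, target (atlas i) x -> forall u : 'rV[R]_n,
    u *m phi i x *m phi i x = - u + pairing (eta i x) u *: xi i x;
  eta_xi : forall i x, target (atlas i) x -> pairing (eta i x) (xi i x) = 1;
  phi_metric : forall i x, target (atlas i) x -> forall u v : 'rV[R]_n,
    form (metric i x) (u *m phi i x) (v *m phi i x) =
    form (metric i x) u v - pairing (eta i x) u * pairing (eta i x) v }.

Section local_geometry.
Variables (R : realType) (n : nat).
Implicit Types (G : 'rV[R]_n -> 'M[R]_n) (X Y Z : 'rV[R]_n -> 'rV[R]_n).
Implicit Types (x u v w z : 'rV[R]_n).

(* G is the matrix of the metric in a chart; [christoffel G k i j] is the symbol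
   with upper index k and lower indices i, j. *)
Definition christoffel G (k i j : 'I_n) x : R :=
  2^-1 * \sum_l invmx (G x) k l *
    (partial i (fun y => G y j l) x + partial j (fun y => G y i l) x
     - partial l (fun y => G y i j) x).

Definition covd G X Y x : 'rV[R]_n :=
  \row_k \sum_i X x 0 i *
    (partial i (fun y => Y y 0 k) x + \sum_j christoffel G k i j x * Y x 0 j).

Definition bracket X Y x : 'rV[R]_n :=
  \row_k \sum_i (X x 0 i * partial i (fun y => Y y 0 k) x
                 - Y x 0 i * partial i (fun y => X y 0 k) x).

Definition curvature G X Y Z x : 'rV[R]_n :=
  covd G X (covd G Y Z) x - covd G Y (covd G X Z) x - covd G (bracket X Y) Z x.

(* R is tensorial, so its value on tangent vectors at x is computed by extending
   them to vector fields with constant components. *)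
Definition riem G x u v w z : R :=
  form (G x) (curvature G (cst u) (cst v) (cst w) x) z.

Definition orthonormal G x (e : 'I_n -> 'rV[R]_n) : Prop :=
  forall a b, form (G x) (e a) (e b) = (a == b)%:R.

Definition ricci G x (e : 'I_n -> 'rV[R]_n) u v : R :=
  \sum_a riem G x (e a) u v (e a).

Definition breveR G x (e : 'I_n -> 'rV[R]_n) u v : R :=
  \sum_a \sum_b \sum_c
    riem G x u (e a) (e b) (e c) * riem G x v (e a) (e b) (e c).

Definition riem_norm2 G x (e : 'I_n -> 'rV[R]_n) : R :=
  \sum_a \sum_b \sum_c \sum_d riem G x (e a) (e b) (e c) (e d) ^+ 2.

(* [christoffel_sym], [covd_torsion_free] and [christoffel_metric] check that
   [covd G] is the Levi-Civita connection of G. *)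
Lemma partial_sym G x k i j : (\forall y \near x, (G y)^T = G y) ->
  partial k (fun y => G y i j) x = partial k (fun y => G y j i) x.
Proof.
move=> Gsym; rewrite /partial; apply: near_eq_derive.
by apply: filterS Gsym => y Gy; rewrite -[in LHS]Gy mxE.
Qed.

Lemma christoffel_sym G x k i j : (\forall y \near x, (G y)^T = G y) ->
  christoffel G k i j x = christoffel G k j i x.
Proof.
move=> Gsym; congr (_ * _); apply: eq_bigr => l _; congr (_ * _).
by rewrite (partial_sym l i j Gsym) [X in X - _]addrC.
Qed.

Lemma covd_torsion_free G X Y x : (\forall y \near x, (G y)^T = G y) ->
  covd G X Y x - covd G Y X x = bracket X Y x.
Proof.
move=> Gsym; apply/rowP => k; rewrite !mxE.
have E (U V : 'rV[R]_n -> 'rV[R]_n) : \sum_i U x 0 i *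
    (partial i (fun y => V y 0 k) x + \sum_j christoffel G k i j x * V x 0 j) =
  \sum_i U x 0 i * partial i (fun y => V y 0 k) x +
  \sum_i \sum_j christoffel G k i j x * (U x 0 i * V x 0 j).
  rewrite -big_split; apply: eq_bigr => i _; rewrite mulrDr; congr (_ + _).
  by rewrite big_distrr; apply: eq_bigr => j _; rewrite mulrCA.
rewrite !E [in X in _ - (_ + X)]exchange_big /=.
under [in X in _ - (_ + X)]eq_bigr do under eq_bigr do
  rewrite (christoffel_sym _ _ _ Gsym) [Y x 0 _ * _]mulrC.
by rewrite opprD addrACA subrr addr0 -sumrB.
Qed.

Lemma christoffel_metric G x k i j :
  (\forall y \near x, (G y)^T = G y) -> G x \in unitmx ->
  partial k (fun y => G y i j) x =
  \sum_l (christoffel G l k i x * G x l j + christoffel G l k j x * G x i l).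
Proof.
move=> Gsym Gu; have Gx : (G x)^T = G x := nbhs_singleton Gsym.
have Gs a b : G x a b = G x b a by rewrite -[in LHS]Gx mxE.
have inv c m : \sum_l invmx (G x) l m * G x l c = (c == m)%:R.
  have := congr1 (fun A : 'M[R]_n => A c m) (mulmxV Gu).
  by rewrite !mxE => <-; apply: eq_bigr => l _; rewrite (Gs c) mulrC.
have low a b c : \sum_l christoffel G l a b x * G x l c =
    2^-1 * (partial a (fun y => G y b c) x + partial b (fun y => G y a c) x
            - partial c (fun y => G y a b) x).
  under eq_bigr do rewrite -mulrA.
  rewrite -big_distrr /=; congr (_ * _).
  under eq_bigr do rewrite big_distrl /=.
  rewrite exchange_big /=.
  under eq_bigr do under eq_bigr do rewrite mulrAC.
  under eq_bigr do rewrite -big_distrl inv /=.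
  rewrite (bigD1 c) //= eqxx mul1r big1 ?addr0 // => m mc.
  by rewrite eq_sym (negbTE mc) mul0r.
rewrite big_split /= low.
under [X in _ + X]eq_bigr do rewrite (Gs i).
rewrite low (partial_sym k j i Gsym) -mulrDr.
set A := partial k _ x; set B := partial i _ x; set C := partial j _ x.
have -> : A + B - C + (A + C - B) = A *+ 2.
  by ring.
by rewrite -[A *+ 2]mulr_natl mulKf // pnatr_eq0.
Qed.

End local_geometry.

Section weakly_eta_einstein.
Variables (R : realType) (n : nat) (M : smooth_manifold R n).

Definition is_ricci_operator (g : riemannian_metric M) (Q : endo_field M) : Prop :=
  forall i x, target (atlas i) x ->
  forall e, orthonormal (g i) x e ->
  forall u v, form (g i x) (u *m Q i x) v = ricci (g i) x e u v.

Definition weakly_eta_einstein (S : almost_contact_metric M) : Prop :=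
  exists alpha beta : M -> R, smooth_function alpha /\ smooth_function beta /\
  forall p i, source (atlas i) p -> let x := atlas i p in
  forall e, orthonormal (metric S i) x e ->
  forall u v, breveR (metric S i) x e u v =
    alpha p * form (metric S i x) u v
    + beta p * (pairing (eta S i x) u * pairing (eta S i x) v).

Definition eta_einstein_ricci_at (S : almost_contact_metric M)
    (Q : endo_field M) (p : M) : Prop :=
  exists a b : R, forall i, source (atlas i) p -> let x := atlas i p in
  forall u : 'rV[R]_n,
    u *m Q i x = a *: u + (b * pairing (eta S i x) u) *: xi S i x.

Definition ricci_xi_eq0_at (S : almost_contact_metric M)
    (Q : endo_field M) (p : M) : Prop :=
  forall i, source (atlas i) p -> let x := atlas i p in xi S i x *m Q i x = 0.

Definition weakly_einstein_at (g : riemannian_metric M) (p : M) : Prop :=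
  forall i, source (atlas i) p -> let x := atlas i p in
  forall e, orthonormal (g i) x e ->
  forall u v, breveR (g i) x e u v =
    riem_norm2 (g i) x e / n%:R * form (g i x) u v.

End weakly_eta_einstein.

(* Main.v *)
Require Import Defs.
From mathcomp Require Import all_boot all_order all_algebra.
From mathcomp Require Import all_classical all_reals all_analysis.
From mathcomp Require Import ring lra.
Set Implicit Arguments.
Unset Strict Implicit.
Unset Printing Implicit Defensive.
Import Order.TTheory GRing.Theory Num.Theory.
Import numFieldNormedType.Exports.
Import Defs.
Local Open Scope classical_set_scope.
Local Open Scope ring_scope.

(** The statement is pointwise, and in dimension three the curvature tensor at
    a point is the same thing as a symmetric endomorphism K of the space of
    2-planes, itself identified with the tangent space by the Hodge star.  In
    an orthonormal frame one finds

      breve R = 2 (|K|^2 I - K^2)    and    Q = K - (tr K) I.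

    So breve R = alpha g + beta eta (x) eta says that K^2 = a I + b xi xi^T,
    with b = - beta / 2.  Where beta = 0, taking the trace gives
    alpha = |R|^2 / 3, which is (iii).  Where beta <> 0, K commutes with K^2,
    hence preserves the line of xi: K = diag (K', l) with K' a symmetric 2 x 2
    matrix such that K'^2 = a I.  If K' is a scalar then K and Q have the
    eta-Einstein form, which is (i); otherwise Cayley-Hamilton gives tr K' = 0,
    so tr K = l and Q xi = l xi - l xi = 0, which is (ii).  This is
    [sym3_square_cases] and [curvature_tensor_cases].

    The existence of K is the statement that the curvature has its algebraic
    symmetries: antisymmetry in each pair of arguments and invariance under
    exchange of the pairs.  The one with analytic content is the antisymmetry
    in the last pair ([riem_antisym34]): it expresses that the second partial
    derivatives of the metric commute, once they are computed with
    d_k G = C_k G + G C_k^T, where C_k is the matrix of Christoffel symbols.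
    The commutation is proved from the mean value theorem
    ([derive_commute]).  The first Bianchi identity ([riem_bianchi]) comes from
    the absence of torsion, and the exchange of pairs follows as usual.

    A frame (u, phi u, xi) adapted to the structure exists at each point
    ([exists_adapted_frame]).  The trichotomy is established in one chart
    around the point and carried to all others by the tensor transformation
    laws; the Jacobian can be cancelled because it carries one positive
    definite metric to another ([chart_change_inj]). *)

(** * Symmetry of second derivatives *)

Section mixed_partials.
Variables (R : realType) (V : normedModType R).
Implicit Types (f : V -> R) (a b x y : V).

Lemma is_derive_line f y a (t : R) : derivable f (y + t *: a) a ->
  is_derive t 1 (fun s : R => f (y + s *: a)) ('D_a f (y + t *: a)).
Proof.
have E : (fun h : R => h^-1 *: ((f (y + (h *: 1 + t) *: a)) - f (y + t *: a))) =
    (fun h : R => h^-1 *: (f (h *: a + (y + t *: a)) - f (y + t *: a))).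
  by apply/funext => h; rewrite [h *: 1]mulr1 scalerDl addrCA.
by move=> df; split; rewrite /derivable /derive /= E.
Qed.

(** Two applications of the mean value theorem, first along [a] to the
    difference in the direction [b], then along [b] to ['D_a f]. *)
Lemma second_difference f a b x (h : R) : 0 < h ->
  (forall s t : R, 0 <= s <= h -> 0 <= t <= h ->
    derivable f (x + s *: a + t *: b) a /\
    derivable ('D_a f) (x + s *: a + t *: b) b) ->
  exists s t : R, [/\ 0 <= s <= h, 0 <= t <= h &
    f (x + h *: a + h *: b) - f (x + h *: a) - f (x + h *: b) + f x =
    h ^+ 2 * 'D_b ('D_a f) (x + s *: a + t *: b)].
Proof.
move=> h0 df.
have zh : 0 <= (0 : R) <= h by rewrite lexx ltW.
pose F (s : R) := f (x + h *: b + s *: a) - f (x + s *: a).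
have dF (s : R) : 0 <= s <= h -> is_derive s 1 F
    ('D_a f (x + h *: b + s *: a) - 'D_a f (x + s *: a)).
  move=> sh; apply: is_deriveB; apply: is_derive_line.
    by rewrite addrAC; apply: (df s h sh _).1; rewrite lexx ltW.
  by have [] := df s 0 sh zh; rewrite scale0r addr0.
have oo_cc (s : R) : s \in `]0, h[ -> 0 <= s <= h.
  by rewrite in_itv /= => /andP[? ?]; rewrite !ltW.
have cont (u du : R -> R) :
    (forall s : R, 0 <= s <= h -> is_derive s 1 u (du s)) ->
    {within `[0, h], continuous u}.
  move=> du_u; apply: derivable_within_continuous => s.
  by rewrite in_itv /= => /du_u[].
have [s /oo_cc sh Es] := MVT h0 (fun s sh => dF s (oo_cc s sh)) (cont _ _ dF).
have dG (t : R) : 0 <= t <= h -> is_derive t 1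
    (fun t => 'D_a f (x + s *: a + t *: b))
    ('D_b ('D_a f) (x + s *: a + t *: b)).
  by move=> th; apply: is_derive_line; have [] := df s t sh th.
have [t /oo_cc th Et] := MVT h0 (fun t th => dG t (oo_cc t th)) (cont _ _ dG).
exists s, t; split=> //.
move: Es Et; rewrite /F !scale0r !addr0 !subr0 ![x + h *: b + _]addrAC => Es Et.
by rewrite expr2 -mulrA [h * 'D_b _ _]mulrC -Et mulrC -Es; ring.
Qed.

(** Schwarz's theorem: the second difference is symmetric in [a] and [b], so
    both mixed derivatives take a common value at points arbitrarily close to
    [x]. *)
Lemma derive_commute f a b x :
  (\forall y \near x, derivable f y a /\ derivable ('D_a f) y b) ->
  (\forall y \near x, derivable f y b /\ derivable ('D_b f) y a) ->
  {for x, continuous ('D_b ('D_a f))} -> {for x, continuous ('D_a ('D_b f))} ->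
  'D_b ('D_a f) x = 'D_a ('D_b f) x.
Proof.
move=> dab dba cab cba; apply/eqP; rewrite -subr_eq0 -normr_le0.
apply/ler_addgt0Pl => e e0; rewrite addr0.
have e2 : 0 < e / 2 by rewrite divr_gt0.
move: (cab) => /cvgrPdist_lt/(_ _ e2) nab.
move: (cba) => /cvgrPdist_lt/(_ _ e2) nba.
have N : nbhs x [set y | ((derivable f y a /\ derivable ('D_a f) y b) /\
    (derivable f y b /\ derivable ('D_b f) y a)) /\
    (`|'D_b ('D_a f) x - 'D_b ('D_a f) y| < e / 2 /\
     `|'D_a ('D_b f) x - 'D_a ('D_b f) y| < e / 2)].
  exact: (filterI (filterI dab dba) (filterI nab nba)).
move: N => /nbhs_ballP[d /= d0 Bd].
pose h := d / (2 * (`|a| + `|b| + 1)).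
have n0 : 0 < 2 * (`|a| + `|b| + 1).
  by rewrite mulr_gt0 // addr_ge0_gt0 ?addr_ge0.
have h0 : 0 < h by rewrite divr_gt0.
(* The square of side h at x stays in the ball of radius d where both mixed
   derivatives are within e / 2 of their values at x. *)
have inB (s t : R) : 0 <= s <= h -> 0 <= t <= h ->
    ball x d (x + s *: a + t *: b).
  move=> /andP[s0 sh] /andP[t0 th]; rewrite -ball_normE /ball_ /=.
  rewrite -addrA opprD addrA subrr add0r normrN.
  apply: (le_lt_trans (ler_normD _ _)); rewrite !normrZ !ger0_norm //.
  apply: (@le_lt_trans _ _ (h * (`|a| + `|b|))).
    by rewrite mulrDr lerD // ler_wpM2r.
  rewrite /h mulrAC ltr_pdivrMr // ltr_pM2l //.
  rewrite mulr_natl mulr2n -addrA ltrDl addrA.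
  by rewrite ltr_pwDr // ?ltr_wpDl ?addr_ge0.
have [|s [t [sh th E]]] := @second_difference f a b x h h0.
  by move=> s t sh th; have [[]] := Bd _ (inB s t sh th).
have [|t' [s' [th' sh' E']]] := @second_difference f b a x h h0.
  move=> s' t' sh' th'; rewrite addrAC.
  by have [[]] := Bd _ (inB t' s' th' sh').
have eh : x + h *: b + h *: a = x + h *: a + h *: b by rewrite addrAC.
have es : x + t' *: b + s' *: a = x + s' *: a + t' *: b by rewrite addrAC.
rewrite eh es in E'.
have {E E'} EE : 'D_b ('D_a f) (x + s *: a + t *: b) =
    'D_a ('D_b f) (x + s' *: a + t' *: b).
  apply: (@mulfI _ (h ^+ 2)); first by rewrite expf_neq0 // gt_eqF.
  by apply: (etrans (esym E) (etrans _ E')); congr (_ + _); rewrite addrAC.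
have [_ [/= lt1 _]] := Bd _ (inB s t sh th).
have [_ [/= _ lt2]] := Bd _ (inB s' t' sh' th').
have close (A B p q : R) :
    `|A - p| < e / 2 -> `|B - q| < e / 2 -> p = q -> `|A - B| <= e.
  move=> Ap Bq pq; rewrite pq in Ap; rewrite [leRHS]splitr.
  apply: le_trans (ler_distD q A B) _; rewrite [`|q - B|]distrC.
  exact: lerD (ltW Ap) (ltW Bq).
exact: close lt1 lt2 EE.
Qed.
End mixed_partials.

(** * Entrywise calculus of matrix-valued functions *)

Section matrix_calculus.
Variables (R : realType) (n : nat).
Implicit Types (x : 'rV[R]_n) (k : 'I_n).

Definition dmx p q k (A : 'rV[R]_n -> 'M[R]_(p, q)) x : 'M[R]_(p, q) :=
  \matrix_(a, b) partial k (fun y => A y a b) x.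

Definition derivable_entries p q (A : 'rV[R]_n -> 'M[R]_(p, q)) x : Prop :=
  forall k a b, derivable (fun y => A y a b) x (delta_mx 0 k).

Lemma is_derive_sum_fun m (h : 'I_m -> 'rV[R]_n -> R) x v :
  (forall i, derivable (h i) x v) ->
  is_derive x v (fun y => \sum_i h i y) (\sum_i 'D_v (h i) x).
Proof.
move=> dh; rewrite -fct_sumE; apply: is_derive_sum => i; exact: derivableP.
Qed.

Lemma is_derive_mulmx p q r (A : 'rV[R]_n -> 'M[R]_(p, q))
    (B : 'rV[R]_n -> 'M[R]_(q, r)) x k a b :
  derivable_entries A x -> derivable_entries B x ->
  is_derive x (delta_mx 0 k) (fun y => (A y *m B y) a b)
    ((dmx k A x *m B x + A x *m dmx k B x) a b).
Proof.
move=> dA dB.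
have dAB c : is_derive x (delta_mx 0 k) (fun y => A y a c * B y c b)
    (A x a c *: partial k (fun y => B y c b) x
     + B x c b *: partial k (fun y => A y a c) x).
  by apply: is_deriveM; apply: derivableP; [apply: dA|apply: dB].
have E : (fun y => (A y *m B y) a b) = (fun y => \sum_c A y a c * B y c b).
  by apply/funext => y; rewrite mxE.
rewrite E; apply: is_derive_eq.
  by apply: is_derive_sum_fun => c; have [] := dAB c.
rewrite !mxE -big_split; apply: eq_bigr => c _; have [_ ->] := dAB c.
by rewrite !mxE addrC; congr (_ + _); exact: mulrC.
Qed.

Lemma derivable_mulmx p q r (A : 'rV[R]_n -> 'M[R]_(p, q))
    (B : 'rV[R]_n -> 'M[R]_(q, r)) x :
  derivable_entries A x -> derivable_entries B x ->
  derivable_entries (fun y => A y *m B y) x.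
Proof. by move=> dA dB k a b; have [] := is_derive_mulmx k a b dA dB. Qed.

Lemma dmx_mul p q r (A : 'rV[R]_n -> 'M[R]_(p, q))
    (B : 'rV[R]_n -> 'M[R]_(q, r)) x k :
  derivable_entries A x -> derivable_entries B x ->
  dmx k (fun y => A y *m B y) x = dmx k A x *m B x + A x *m dmx k B x.
Proof.
move=> dA dB; apply/matrixP => a b; rewrite [LHS]mxE /partial.
by have [_ ->] := is_derive_mulmx k a b dA dB.
Qed.

Lemma dmx_add p q (A B : 'rV[R]_n -> 'M[R]_(p, q)) x k :
  derivable_entries A x -> derivable_entries B x ->
  dmx k (fun y => A y + B y) x = dmx k A x + dmx k B x.
Proof.
move=> dA dB; apply/matrixP => a b; rewrite !mxE /partial.
under eq_fun do rewrite mxE.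
exact: deriveD (dA k a b) (dB k a b).
Qed.

Lemma dmx_tr p q (A : 'rV[R]_n -> 'M[R]_(p, q)) x k :
  dmx k (fun y => (A y)^T) x = (dmx k A x)^T.
Proof.
by apply/matrixP => a b; rewrite !mxE; under eq_fun do rewrite mxE.
Qed.

Lemma derivable_tr p q (A : 'rV[R]_n -> 'M[R]_(p, q)) x :
  derivable_entries A x -> derivable_entries (fun y => (A y)^T) x.
Proof. by move=> dA k a b; under eq_fun do rewrite mxE; exact: dA. Qed.

Lemma dmx_near p q (A B : 'rV[R]_n -> 'M[R]_(p, q)) x k :
  (\forall y \near x, A y = B y) -> dmx k A x = dmx k B x.
Proof.
move=> AB; apply/matrixP => a b; rewrite !mxE; apply: near_eq_derive.
by apply: filterS AB => y ->.
Qed.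

Lemma dmx_cst p q (A : 'M[R]_(p, q)) x k : dmx k (cst A) x = 0.
Proof. by apply/matrixP => a b; rewrite !mxE; exact: derive_cst. Qed.

Lemma derivable_entries_cst p q (A : 'M[R]_(p, q)) x :
  derivable_entries (cst A) x.
Proof. by move=> k a b; exact: derivable_cst. Qed.

Lemma dmx_mull p q r (C : 'M[R]_(p, q)) (A : 'rV[R]_n -> 'M[R]_(q, r)) x k :
  derivable_entries A x -> dmx k (fun y => C *m A y) x = C *m dmx k A x.
Proof.
move=> dA; have -> := dmx_mul k (@derivable_entries_cst _ _ C x) dA.
by rewrite dmx_cst mul0mx add0r.
Qed.

Lemma dmx_lincomb m p q (c : 'I_m -> R) (A : 'I_m -> 'rV[R]_n -> 'M[R]_(p, q))
    x k : (forall l, derivable_entries (A l) x) ->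
  dmx k (fun y => \sum_l c l *: A l y) x = \sum_l c l *: dmx k (A l) x.
Proof.
move=> dA; apply/matrixP => a b; rewrite mxE summxE /partial.
have E : (fun y => (\sum_l c l *: A l y) a b) =
    (fun y => \sum_l (c l *: A l y) a b).
  by apply/funext => y; rewrite summxE.
have dcA l : is_derive x (delta_mx 0 k) (fun y => (c l *: A l y) a b)
    (c l *: partial k (fun y => A l y a b) x).
  under eq_fun do rewrite mxE.
  exact: (is_deriveZ (c l) (derivableP (dA l k a b))).
have [|_ D] := @is_derive_sum_fun _ (fun l y => (c l *: A l y) a b)
  x (delta_mx 0 k).
  by move=> l; have [] := dcA l.
rewrite E D; apply: eq_bigr => l _.
by have [_ ->] := dcA l; rewrite !mxE.
Qed.

Lemma derivable_prod_fun (I : Type) (s : seq I) (h : I -> 'rV[R]_n -> R) x v :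
  (forall i, derivable (h i) x v) ->
  derivable (fun y => \prod_(i <- s) h i y) x v.
Proof.
move=> dh; elim: s => [|i s IH].
  by under eq_fun do rewrite big_nil; exact: derivable_cst.
under eq_fun do rewrite big_cons; exact: (derivableM (dh i) IH).
Qed.

Lemma derivable_sum_fun (I : Type) (s : seq I) (h : I -> 'rV[R]_n -> R) x v :
  (forall i, derivable (h i) x v) ->
  derivable (fun y => \sum_(i <- s) h i y) x v.
Proof.
move=> dh; elim: s => [|i s IH].
  by under eq_fun do rewrite big_nil; exact: derivable_cst.
under eq_fun do rewrite big_cons; exact: (derivableD (dh i) IH).
Qed.

Lemma derivable_mulc (c : R) (h : 'rV[R]_n -> R) x v :
  derivable h x v -> derivable (fun y => c * h y) x v.
Proof. exact: derivableM (derivable_cst c x v). Qed.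

Lemma derivable_det m (A : 'rV[R]_n -> 'M[R]_m) x k : derivable_entries A x ->
  derivable (fun y => \det (A y)) x (delta_mx 0 k).
Proof.
move=> dA; apply: derivable_sum_fun => s.
by apply: derivable_mulc; apply: derivable_prod_fun => i; exact: dA.
Qed.

(** Cramer's rule makes the inverse rational in the entries. *)
Lemma derivable_invmx m (A : 'rV[R]_n -> 'M[R]_m) x :
  (\forall y \near x, A y \in unitmx) -> derivable_entries A x ->
  derivable_entries (fun y => invmx (A y)) x.
Proof.
move=> uA dA k a b.
apply: (@near_eq_derivable _ _ _
  (fun y => (\det (A y))^-1 *
    ((-1) ^+ (b + a) * \det (row' b (col' a (A y)))))).
  by apply: filterS uA => y uy; rewrite /invmx uy !mxE.
apply: derivableM.
  apply: derivableV; last exact: derivable_det.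
  by have := nbhs_singleton uA; rewrite unitmxE unitfE.
apply: derivable_mulc; apply: derivable_det => k' a' b'.
by under eq_fun do rewrite !mxE; exact: dA.
Qed.

End matrix_calculus.

(** * Symmetries of the curvature tensor *)

Section curvature_symmetries.
Variables (R : realType) (n : nat).
Variables (U : set 'rV[R]_n) (G : 'rV[R]_n -> 'M[R]_n).
Hypotheses (U_open : open U) (G_smooth : smooth_on U G).
Hypothesis G_sym : forall y, U y -> (G y)^T = G y.
Hypothesis G_unit : forall y, U y -> G y \in unitmx.
Implicit Types (x u v w z : 'rV[R]_n) (k l : 'I_n).

(** On row vectors, the covariant derivative along the [k]-th coordinate field
    is [Y |-> dmx k Y + Y *m conn_mx k]. *)
Definition conn_mx k x : 'M[R]_n := \matrix_(j, m) christoffel G m k j x.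

(** A field with constant components [w], differentiated along the [l]-th and
    then along the [k]-th coordinate field, becomes [w *m covd2_mx k l]. *)
Definition covd2_mx k l x : 'M[R]_n :=
  dmx k (conn_mx l) x + conn_mx l x *m conn_mx k x.

Let near_U x (P : 'rV[R]_n -> Prop) : U x -> (forall y, U y -> P y) ->
  \forall y \near x, P y.
Proof. by move=> Ux UP; apply: filterS (open_nbhs_nbhs (conj U_open Ux)). Qed.

Lemma derivable_metric x : U x -> derivable_entries G x.
Proof.
by move=> Ux k a b; have [_ /(_ k)[d _]] := G_smooth a b 1; exact: d.
Qed.

Lemma derivable_dmetric x k : U x -> derivable_entries (dmx k G) x.
Proof.
move=> Ux l a b; under eq_fun do rewrite mxE.
by have [_ /(_ k)[_ [_ /(_ l)[d _]]]] := G_smooth a b 2; exact: d.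
Qed.

Lemma dmx_metric_commute x k l : U x ->
  dmx k (dmx l G) x = dmx l (dmx k G) x.
Proof.
have E i j y a b : dmx i (dmx j G) y a b =
    partial i (partial j (fun y => G y a b)) y.
  by rewrite mxE; congr (partial i _ y); apply/funext => y'; rewrite mxE.
move=> Ux; apply/matrixP => a b.
apply: etrans (E k l x a b) (etrans _ (esym (E l k x a b))).
have [_ C2] := G_smooth a b 2.
apply: derive_commute.
- apply: near_U Ux _ => y Uy.
  by have [dl [_ /(_ k)[dk _]]] := C2 l; split; auto.
- apply: near_U Ux _ => y Uy.
  by have [dl [_ /(_ l)[dk _]]] := C2 k; split; auto.
- by have [_ [_ /(_ k)[_ [c _]]]] := C2 l; exact: c.
- by have [_ [_ /(_ l)[_ [c _]]]] := C2 k; exact: c.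
Qed.

Lemma derivable_conn_mx x k : U x -> derivable_entries (conn_mx k) x.
Proof.
move=> Ux l j m; under eq_fun do rewrite mxE.
apply: derivable_mulc; apply: derivable_sum_fun => i.
have dG a b c : derivable (partial a (fun y => G y b c)) x (delta_mx 0 l).
  by have := @derivable_dmetric x a Ux l b c; under eq_fun do rewrite mxE.
apply: derivableM.
  exact: (derivable_invmx (near_U Ux G_unit) (derivable_metric Ux)).
exact: (derivableB (derivableD (dG _ _ _) (dG _ _ _)) (dG _ _ _)).
Qed.

(** The connection is metric: this is [christoffel_metric] in matrix form. *)
Lemma dmx_metric x k : U x ->
  dmx k G x = conn_mx k x *m G x + G x *m (conn_mx k x)^T.
Proof.
move=> Ux; apply/matrixP => a b; rewrite mxE.
rewrite (christoffel_metric _ _ _ (near_U Ux G_sym) (G_unit Ux)) big_split !mxE.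
congr (_ + _); apply: eq_bigr => l _; rewrite !mxE //.
exact: mulrC.
Qed.

(** Differentiating [dmx_metric] once more.  The last two terms are grouped
    because their sum is symmetric in [k] and [l], so that they disappear on
    antisymmetrization. *)
Lemma dmx_dmx_metric x k l : U x -> dmx k (dmx l G) x =
  (covd2_mx k l x *m G x + G x *m (covd2_mx k l x)^T) +
  (conn_mx l x *m G x *m (conn_mx k x)^T +
   conn_mx k x *m G x *m (conn_mx l x)^T).
Proof.
move=> Ux; have dG := derivable_metric Ux.
have dC := @derivable_conn_mx x l Ux.
rewrite (dmx_near k (near_U Ux (@dmx_metric ^~ l))).
have dCG := derivable_mulmx dC dG.
have dGC := derivable_mulmx dG (derivable_tr dC).
rewrite (dmx_add k dCG dGC) (dmx_mul k dC dG) (dmx_mul k dG (derivable_tr dC)).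
have trD (A B : 'M[R]_n) : (A + B)^T = A^T + B^T by rewrite linearD.
rewrite dmx_tr (dmx_metric k Ux) /covd2_mx trD trmx_mul.
move: (dmx k (conn_mx l) x) (conn_mx l x) (conn_mx k x) (G x) => D L K H.
rewrite !mulmxDl !mulmxDr !mulmxA.
(* only the order of the six terms differs *)
by rewrite [LHS](AC ((1*2)*(2*1)) (((1*2)*(6*5))*(3*4))).
Qed.

(** The infinitesimal form of the fact that parallel transport is an isometry:
    the curvature endomorphisms are skew-adjoint for the metric.  By
    [dmx_metric_commute] the left side of [dmx_dmx_metric] is symmetric in [k]
    and [l]. *)
Lemma covd2_mx_skew x k l : U x ->
  (covd2_mx k l x - covd2_mx l k x) *m G x +
  G x *m (covd2_mx k l x - covd2_mx l k x)^T = 0.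
Proof.
move=> Ux; have := etrans (esym (dmx_dmx_metric k l Ux))
  (etrans (dmx_metric_commute k l Ux) (dmx_dmx_metric l k Ux)).
rewrite [X in _ = _ + X]addrC => /addIr E.
have trB (A B : 'M[R]_n) : (A - B)^T = A^T - B^T by rewrite linearB.
rewrite trB mulmxBl mulmxBr.
apply/eqP; rewrite addrACA -opprD subr_eq0; exact/eqP.
Qed.

(** The curvature endomorphism of [u] and [v], acting on row vectors. *)
Definition curvature_mx u v x : 'M[R]_n :=
  \sum_k \sum_l (u 0 k * v 0 l) *: (covd2_mx k l x - covd2_mx l k x).

Lemma covdE (X Y : 'rV[R]_n -> 'rV[R]_n) x :
  covd G X Y x = \sum_k X x 0 k *: (dmx k Y x + Y x *m conn_mx k x).
Proof.
apply/rowP => m; rewrite mxE summxE; apply: eq_bigr => k _.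
rewrite [RHS]mxE; congr (_ * _); rewrite [RHS]mxE; congr (_ + _).
  by rewrite mxE.
by rewrite mxE; apply: eq_bigr => j _; rewrite [in RHS]mxE mulrC.
Qed.

Lemma covd_cst v w : covd G (cst v) (cst w) =
  fun y => \sum_l v 0 l *: (w *m conn_mx l y).
Proof.
by apply/funext => y; rewrite covdE; under eq_bigr do rewrite dmx_cst add0r.
Qed.

Lemma covd_covd_cst u v w x : U x ->
  covd G (cst u) (covd G (cst v) (cst w)) x =
  w *m \sum_k \sum_l (u 0 k * v 0 l) *: covd2_mx k l x.
Proof.
move=> Ux; rewrite covd_cst covdE mulmx_sumr; apply: eq_bigr => k _.
rewrite dmx_lincomb; last first.
  move=> l; apply: derivable_mulmx; first exact: derivable_entries_cst.
  exact: derivable_conn_mx.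
rewrite mulmx_suml -big_split scaler_sumr mulmx_sumr; apply: eq_bigr => l _ /=.
rewrite dmx_mull; last exact: derivable_conn_mx.
by rewrite -scalemxAl -scalerDr scalerA -scalemxAr mulmxDr mulmxA.
Qed.

Lemma bracket_cst u v x : bracket (cst u) (cst v) x = 0.
Proof.
apply/rowP => k; rewrite !mxE big1 // => i _.
by rewrite /partial !derive_cst !mulr0 subr0.
Qed.

Lemma covd_bracket_cst u v w x :
  covd G (bracket (cst u) (cst v)) (cst w) x = 0.
Proof.
rewrite covdE big1 // => k _.
by rewrite bracket_cst mxE scale0r.
Qed.

Lemma curvature_cst u v w x : U x ->
  curvature G (cst u) (cst v) (cst w) x = w *m curvature_mx u v x.
Proof.
move=> Ux; rewrite /curvature covd_bracket_cst subr0 !covd_covd_cst // -mulmxBr.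
congr (_ *m _); rewrite [X in _ - X]exchange_big -sumrB; apply: eq_bigr => k _.
rewrite -sumrB; apply: eq_bigr => l _.
by rewrite scalerBr [v 0 l * _]mulrC.
Qed.

Lemma curvature_mx_skew u v x : U x ->
  curvature_mx u v x *m G x + G x *m (curvature_mx u v x)^T = 0.
Proof.
move=> Ux; rewrite /curvature_mx.
rewrite mulmx_suml linear_sum mulmx_sumr -big_split big1 //.
move=> k _; rewrite mulmx_suml linear_sum mulmx_sumr -big_split big1 //= => l _.
rewrite linearZ /= -scalemxAl -scalemxAr -scalerDr.
by have -> := covd2_mx_skew k l Ux; rewrite scaler0.
Qed.

Lemma riem_antisym34 x u v w z : U x -> riem G x u v w z = - riem G x u v z w.
Proof.
move=> Ux; rewrite /riem /form !curvature_cst //; apply/eqP; rewrite -addr_eq0.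
have tr00 (A : 'M[R]_1) : A 0 0 = A^T 0 0 by rewrite mxE.
rewrite [X in _ + X]tr00 !trmx_mul !trmxK G_sym //.
have := curvature_mx_skew u v Ux; move: (curvature_mx u v x) (G x) => C H CH.
have <- : (w *m C *m H *m z^T + w *m (H *m (C^T *m z^T))) 0 0 =
  (w *m C *m H *m z^T) 0 0 + (w *m (H *m (C^T *m z^T))) 0 0 by rewrite mxE.
have -> : w *m C *m H *m z^T + w *m (H *m (C^T *m z^T)) =
  w *m (C *m H + H *m C^T) *m z^T by rewrite mulmxDr mulmxDl !mulmxA.
by rewrite CH mulmx0 mul0mx mxE.
Qed.

Lemma riem_antisym12 x u v w z : riem G x u v w z = - riem G x v u w z.
Proof.
rewrite /riem /form /curvature !covd_bracket_cst !subr0.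
move: (covd _ _ _ _) (covd _ _ _ _) => A B.
by rewrite -(opprB B) !mulNmx [in RHS]mxE opprK.
Qed.

Lemma covd_cst_sym v w y : U y ->
  covd G (cst v) (cst w) y = covd G (cst w) (cst v) y.
Proof.
move=> Uy; apply/eqP; rewrite -subr_eq0.
by rewrite (covd_torsion_free _ _ (near_U Uy G_sym)) bracket_cst.
Qed.

(** Without torsion, [covd (cst v) (cst w)] is symmetric in [v] and [w] near
    [x], and then the six second derivatives cancel in pairs. *)
Lemma riem_bianchi x u v w z : U x ->
  riem G x u v w z + riem G x v w u z + riem G x w u v z = 0.
Proof.
move=> Ux.
have S a b c : covd G (cst a) (covd G (cst b) (cst c)) x =
    covd G (cst a) (covd G (cst c) (cst b)) x.
  rewrite [LHS]covdE [RHS]covdE; apply: eq_bigr => k _.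
  by rewrite (dmx_near k (near_U Ux (@covd_cst_sym b c))) (covd_cst_sym b c Ux).
have D (A B C : 'rV[R]_n) :
    form (G x) A z + form (G x) B z + form (G x) C z = form (G x) (A + B + C) z.
  by rewrite /form !mulmxDl !mxE.
rewrite /riem D /curvature !covd_bracket_cst !subr0.
rewrite (S u w v) (S v u w) (S w v u).
move: (covd G (cst u) _ x) (covd G (cst v) _ x) (covd G (cst w) _ x) => A B C.
by rewrite addrAC [A - B + _]addrC !addrA subrK subrK subrr /form !mul0mx mxE.
Qed.

(** The octahedron argument: combine the Bianchi identities obtained from the
    four cyclic shifts of the arguments. *)
Lemma riem_pair_sym x u v w z : U x -> riem G x u v w z = riem G x w z u v.
Proof.
move=> Ux.
have B1 := riem_bianchi u v w z Ux; have B2 := riem_bianchi v w z u Ux.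
have B3 := riem_bianchi w z u v Ux; have B4 := riem_bianchi z u v w Ux.
(* Together these reduce the twelve values in the Bianchi identities to six. *)
have E2 : riem G x v w z u = - riem G x v w u z by exact: riem_antisym34.
have E3 : riem G x w z v u = - riem G x w z u v by exact: riem_antisym34.
have E4 : riem G x u w z v = riem G x w u v z.
  by rewrite riem_antisym12 riem_antisym34 ?opprK.
have E5 : riem G x z u v w = - riem G x z u w v by exact: riem_antisym34.
have E6 : riem G x u v z w = - riem G x u v w z by exact: riem_antisym34.
have E7 : riem G x v z u w = riem G x z v w u.
  by rewrite riem_antisym12 riem_antisym34 ?opprK.
move: E2 E3 E4 E5 E6 E7 B1 B2 B3 B4.
move: (riem G x u v w z) (riem G x w z u v) => p q.
do 10!move: (riem _ _ _ _ _ _).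
clear; move=> *; lra.
Qed.

End curvature_symmetries.

(** * Curvature tensors in dimension three *)

Section algebra_dim3.
Variable R : realFieldType.

(** With K the symmetric matrix [C, -F, E; -F, B, -D; E, -D, A], the hypotheses
    say that K^2 = diag (al, al, al + be).  The entries of K K^2 = K^2 K in the
    last column give be E = be D = 0; the remaining 2 x 2 block has a scalar
    square, so it is scalar or traceless. *)
Lemma sym3_square_cases (A B C D E F al be : R) : be != 0 ->
  C ^+ 2 + F ^+ 2 + E ^+ 2 = al -> B ^+ 2 + F ^+ 2 + D ^+ 2 = al ->
  A ^+ 2 + D ^+ 2 + E ^+ 2 = al + be ->
  F * (B + C) + D * E = 0 -> E * (A + C) + D * F = 0 ->
  D * (A + B) + E * F = 0 ->
  [/\ D = 0, E = 0 & (F = 0 /\ B = C) \/ B + C = 0].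
Proof.
move=> be0 K00 K11 K22 K01 K02 K12.
have D0 : D = 0.
  apply: (mulfI be0).
  have -> : be * D = E * (F * (B + C) + D * E) - F * (E * (A + C) + D * F)
      + (A - B) * (D * (A + B) + E * F)
      + D * (B ^+ 2 + F ^+ 2 + D ^+ 2 - al)
      - D * (A ^+ 2 + D ^+ 2 + E ^+ 2 - (al + be)) by ring.
  by rewrite K01 K02 K12 K11 K22 !subrr !mulr0 !subr0 !addr0.
have E0 : E = 0.
  apply: (mulfI be0).
  have -> : be * E = D * (F * (B + C) + D * E) - F * (D * (A + B) + E * F)
      + (A - C) * (E * (A + C) + D * F)
      + E * (C ^+ 2 + F ^+ 2 + E ^+ 2 - al)
      - E * (A ^+ 2 + D ^+ 2 + E ^+ 2 - (al + be)) by ring.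
  by rewrite K01 K02 K12 K00 K22 !subrr !mulr0 !subr0 !addr0.
split=> //; have [BC|BC] := eqVneq (B + C) 0; [by right|left].
move: K00 K11 K01; rewrite D0 E0 mul0r !expr0n !addr0 => K00 K11 /eqP.
rewrite mulf_eq0 (negbTE BC) orbF => /eqP F0; split=> //.
apply/eqP; rewrite -subr_eq0; apply/eqP/(mulIf BC).
have -> : (B - C) * (B + C) = (B ^+ 2 + F ^+ 2) - (C ^+ 2 + F ^+ 2) by ring.
by rewrite K00 K11 subrr mul0r.
Qed.

(** Closed terms, so that equality tests between the indices compute. *)
Definition o0 : 'I_3 := ord0.
Definition o1 : 'I_3 := lift ord0 ord0.
Definition o2 : 'I_3 := ord_max.

Lemma sum_I3 (f : 'I_3 -> R) : \sum_i f i = f o0 + f o1 + f o2.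
Proof.
rewrite !big_ord_recl big_ord0 addr0 addrA; congr (_ + f _).
exact: val_inj.
Qed.

Lemma ord3P (i : 'I_3) : [\/ i = o0, i = o1 | i = o2].
Proof.
case: i => [[|[|[|//]]] lt_i3]; [constructor 1|constructor 2|constructor 3];
  exact: val_inj.
Qed.

(** The six numbers [T a b c d] with [a < b] and [c < d] determine [T]; as the
    entries of K in [sym3_square_cases] they are indexed by the axes orthogonal
    to the planes (a, b) and (c, d), with signs.  The diagonal terms of breve R
    are 2 (|K|^2 - (K^2)_pp), so the last diagonal entry of K^2 exceeds the
    other two by - be / 2. *)
Lemma curvature_tensor_cases (T : 'I_3 -> 'I_3 -> 'I_3 -> 'I_3 -> R)
    (al be : R) :
  (forall a b c d, T a b c d = - T b a c d) ->
  (forall a b c d, T a b c d = - T a b d c) ->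
  (forall a b c d, T a b c d = T c d a b) ->
  be != 0 ->
  (forall p q, \sum_a \sum_b \sum_c T p a b c * T q a b c =
     al * (p == q)%:R + be * ((p == o2)%:R * (q == o2)%:R)) ->
  (exists a b, forall p q, \sum_c T c p q c =
     a * (p == q)%:R + b * ((p == o2)%:R * (q == o2)%:R)) \/
  (forall q, \sum_c T c o2 q c = 0).
Proof.
move=> T12 T34 Tpair be0 breveT.
have T0 a c d : T a a c d = 0.
  by apply/eqP; rewrite -[_ == _](mulrn_eq0 _ 2) mulr2n {1}T12 addNr.
have T0' a b c : T a b c c = 0 by rewrite Tpair T0.
have e10 c d : T o1 o0 c d = - T o0 o1 c d by exact: T12.
have e20 c d : T o2 o0 c d = - T o0 o2 c d by exact: T12.
have e21 c d : T o2 o1 c d = - T o1 o2 c d by exact: T12.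
have f10 c d : T c d o1 o0 = - T c d o0 o1 by exact: T34.
have f20 c d : T c d o2 o0 = - T c d o0 o2 by exact: T34.
have f21 c d : T c d o2 o1 = - T c d o1 o2 by exact: T34.
have g1 : T o0 o2 o0 o1 = T o0 o1 o0 o2 by exact: Tpair.
have g2 : T o1 o2 o0 o1 = T o0 o1 o1 o2 by exact: Tpair.
have g3 : T o1 o2 o0 o2 = T o0 o2 o1 o2 by exact: Tpair.
have red := (T0, T0', e10, e20, e21, f10, f20, f21, g1, g2, g3).
have := (breveT o0 o0, breveT o1 o1, breveT o2 o2, breveT o0 o1, breveT o0 o2,
  breveT o1 o2).
rewrite !sum_I3 !red /=.
have ricT p q : \sum_c T c p q c = T o0 p q o0 + T o1 p q o1 + T o2 p q o2.
  exact: sum_I3.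
(* All components of T are now expressed by these six. *)
pose A := T o0 o1 o0 o1; pose B := T o0 o2 o0 o2; pose C := T o1 o2 o1 o2.
pose D := T o0 o1 o0 o2; pose E := T o0 o1 o1 o2; pose F := T o0 o2 o1 o2.
rewrite -/A -/B -/C -/D -/E -/F => -[[[[[K00 K11] K22] K01] K02] K12].
have [|||||||D0 E0 cases] := @sym3_square_cases A B C D E F
  (C ^+ 2 + F ^+ 2 + E ^+ 2) (- be / 2).
- by rewrite mulf_neq0 ?oppr_eq0 // invr_eq0 pnatr_eq0.
- by [].
- by move: K00 K11; clear; move=> *; lra.
- by move: K00 K22; clear; move=> *; lra.
- by move: K01; clear; move=> *; lra.
- by move: K02; clear; move=> *; lra.
- by move: K12; clear; move=> *; lra.
case: cases => [[F0 BC]|BC]; [left|right].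
  exists (- A - B), (A - B) => p q; rewrite ricT.
  case: (ord3P p) => ->; case: (ord3P q) => ->;
    rewrite !red -/A -/B -/C -/D -/E -/F /= ?D0 ?E0 ?F0 -?BC; ring.
move=> q; rewrite ricT.
case: (ord3P q) => ->; rewrite !red -/A -/B -/C -/D -/E -/F ?D0 ?E0; lra.
Qed.
End algebra_dim3.

(** * Frames, metrics and almost contact structures *)

Lemma form_scalel (R : realType) n (A : 'M[R]_n) (u v : 'rV[R]_n) c :
  form A (c *: u) v = c * form A u v.
Proof. by rewrite /form -!scalemxAl mxE. Qed.

Lemma form_scaler (R : realType) n (A : 'M[R]_n) (u v : 'rV[R]_n) c :
  form A u (c *: v) = c * form A u v.
Proof. by rewrite /form linearZ -scalemxAr mxE. Qed.

Lemma form_addl (R : realType) n (A : 'M[R]_n) (u v w : 'rV[R]_n) :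
  form A (u + v) w = form A u w + form A v w.
Proof. by rewrite /form !mulmxDl mxE. Qed.

Lemma form_addr (R : realType) n (A : 'M[R]_n) (u v w : 'rV[R]_n) :
  form A u (v + w) = form A u v + form A u w.
Proof. by rewrite /form linearD mulmxDr mxE. Qed.

Lemma form_oppl (R : realType) n (A : 'M[R]_n) (u v : 'rV[R]_n) :
  form A (- u) v = - form A u v.
Proof. by rewrite -scaleN1r form_scalel mulN1r. Qed.

Lemma form_oppr (R : realType) n (A : 'M[R]_n) (u v : 'rV[R]_n) :
  form A u (- v) = - form A u v.
Proof. by rewrite -scaleN1r form_scaler mulN1r. Qed.

Lemma form_0r (R : realType) n (A : 'M[R]_n) (u : 'rV[R]_n) : form A u 0 = 0.
Proof. by rewrite -(scale0r 0) form_scaler mul0r. Qed.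

Section orthonormal_frames.
Variables (R : realType) (n : nat) (G : 'rV[R]_n -> 'M[R]_n) (x : 'rV[R]_n).
Variables (e : 'I_n -> 'rV[R]_n).
Hypothesis e_on : orthonormal G x e.

Let E : 'M[R]_n := \matrix_a e a.

Let frame_coord (w : 'rV[R]_n) b : (w *m (G x *m E^T)) 0 b = form (G x) w (e b).
Proof.
rewrite /form -mulmxA !mxE; apply: eq_bigr => j _; congr (_ * _); rewrite !mxE.
by apply: eq_bigr => l _; rewrite !mxE.
Qed.

Let frame_gram : E *m (G x *m E^T) = 1%:M.
Proof.
apply/matrixP => a b; rewrite [RHS]mxE -e_on -frame_coord.
by rewrite -[e a](rowK e) -row_mul [RHS]mxE.
Qed.

Lemma frame_nondegenerate w : (forall b, form (G x) w (e b) = 0) -> w = 0.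
Proof.
move=> we; have wE : w *m (G x *m E^T) = 0.
  by apply/rowP => b; rewrite frame_coord we mxE.
by rewrite -[w]mulmx1 -(mulmx1C frame_gram) mulmxA wE mul0mx.
Qed.

Lemma frame_spans (A B : 'M[R]_n) : (forall a, e a *m A = e a *m B) -> A = B.
Proof.
move=> AB; have EAB : E *m A = E *m B.
  by apply/row_matrixP => a; rewrite !row_mul rowK.
by rewrite -[A]mul1mx -[B]mul1mx -(mulmx1C frame_gram) -!mulmxA EAB.
Qed.

End orthonormal_frames.

Section metric_facts.
Variables (R : realType) (n : nat) (M : smooth_manifold R n).
Variable (g : riemannian_metric M).
Implicit Types (i j : chart_index M).

Lemma metric_trmx i y : target (atlas i) y -> (g i y)^T = g i y.
Proof.
move=> Uy; apply/matrixP => a b.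
have := metric_sym g Uy (delta_mx 0 b) (delta_mx 0 a).
by rewrite /form !trmx_delta -!rowE -!colE !mxE.
Qed.

Lemma metric_unitmx i y : target (atlas i) y -> g i y \in unitmx.
Proof.
move=> Uy; rewrite -row_free_unit -kermx_eq0; apply/negPn/negP => K0.
have v0 : nz_row (kermx (g i y)) != 0 by rewrite nz_row_eq0.
have := metric_pos g Uy v0; rewrite /form (sub_kermxP (nz_row_sub _)).
by rewrite mul0mx mxE ltxx.
Qed.

(** A vector killed by the Jacobian would have length zero, as the metric in
    one chart is the pullback of the metric in the other. *)
Lemma chart_change_inj i j z (v : 'rV[R]_n) :
  source (atlas i) z -> source (atlas j) z ->
  v *m 'J (atlas j \o param (atlas i)) (atlas i z) = 0 -> v = 0.
Proof.
move=> zi zj vJ; apply/eqP/negPn/negP => v0.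
have := metric_pos g (coord_target zi) v0.
by rewrite (comp_change g zi zj) /form !mulmxA vJ !mul0mx mxE ltxx.
Qed.

Lemma riem_norm2_trace i x e :
  riem_norm2 (g i) x e = \sum_a breveR (g i) x e (e a) (e a).
Proof.
by do 4!(apply: eq_bigr => ? _); rewrite expr2.
Qed.

End metric_facts.

Section almost_contact.
Variables (R : realType) (n : nat) (M : smooth_manifold R n).
Variables (S : almost_contact_metric M) (i : chart_index M) (x : 'rV[R]_n).
Hypothesis Ux : target (atlas i) x.

Let P := phi S i x.
Let X := xi S i x.
Let h := eta S i x.
Let g := metric S i x.

Let PP u : u *m P *m P = - u + pairing h u *: X.
Proof. exact: phi_sq. Qed.

Let hX : pairing h X = 1.
Proof. exact: eta_xi. Qed.

Let gP u v : form g (u *m P) (v *m P) = form g u v - pairing h u * pairing h v.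
Proof. exact: phi_metric. Qed.

Lemma xi_neq0 : xi S i x != 0.
Proof.
apply/eqP => X0; move: hX; rewrite /X X0 /pairing mul0mx mxE => /esym/eqP.
by rewrite oner_eq0.
Qed.

(** [phi (phi xi) = 0], and applying the identity for [phi^2] to [phi xi] shows
    that [phi xi = c xi] for some [c]; then [c^2 xi = 0]. *)
Lemma phi_xi : xi S i x *m phi S i x = 0.
Proof.
rewrite -/X -/P.
have PPX : X *m P *m P = 0 by rewrite PP hX scale1r addNr.
have := PP (X *m P); rewrite PPX mul0mx => /esym/eqP.
rewrite addrC addr_eq0 opprK; set c := pairing h _ => /eqP cX.
move: PPX; rewrite -cX -scalemxAl -cX scalerA => /eqP.
rewrite scaler_eq0 (negbTE xi_neq0) orbF mulf_eq0 orbb => /eqP ->.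
by rewrite scale0r.
Qed.

(** Compute [phi^3 u] in two ways. *)
Lemma eta_phi u : pairing (eta S i x) (u *m phi S i x) = 0.
Proof.
have := PP (u *m P).
rewrite (PP u) mulmxDl mulNmx -scalemxAl [X *m P]phi_xi scaler0.
rewrite addr0 -[LHS]addr0 => /addrI/esym/eqP.
rewrite scaler_eq0 (negbTE xi_neq0) orbF => /eqP.
exact.
Qed.

Lemma metric_xi u : form (metric S i x) u (xi S i x) = pairing (eta S i x) u.
Proof.
have := gP u X; rewrite [X *m P]phi_xi form_0r hX mulr1 => /esym/eqP.
by rewrite subr_eq0 => /eqP.
Qed.

(** Since [phi] is an isometry on the kernel of [eta] and squares to [-1] there,
    it is skew-adjoint. *)
Lemma metric_phi_self u : form (metric S i x) u (u *m phi S i x) = 0.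
Proof.
have := gP u (u *m P); rewrite [pairing h (u *m P)]eta_phi mulr0 subr0 PP.
rewrite form_addr form_oppr form_scaler [form _ _ X]metric_xi.
rewrite eta_phi mulr0 addr0.
rewrite [in LHS]metric_sym // => /eqP.
by rewrite eq_sym -addr_eq0 -mulr2n mulrn_eq0 => /eqP.
Qed.

End almost_contact.

(** Take [(u, phi u, xi)] with [u] a unit vector in the kernel of [eta]. *)
Lemma exists_adapted_frame (R : realType) (M : smooth_manifold R 3)
    (S : almost_contact_metric M) (i : chart_index M) x : target (atlas i) x ->
  exists e : 'I_3 -> 'rV[R]_3, [/\ orthonormal (metric S i) x e,
    e o2 = xi S i x & forall a, pairing (eta S i x) (e a) = (a == o2)%:R].
Proof.
move=> Ux; set g := metric S i; set h := eta S i x; set X := xi S i x.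
(* eta has rank at most one on a space of dimension three. *)
have [v v0 hv] : exists2 v : 'rV[R]_3, v != 0 & pairing h v = 0.
  exists (nz_row (kermx h)).
    rewrite nz_row_eq0 -mxrank_eq0 mxrank_ker subn_eq0 -ltnNge.
    exact: leq_ltn_trans (rank_leq_col h) _.
  by rewrite /pairing (sub_kermxP (nz_row_sub _)) mxE.
have gv : 0 < form (g x) v v by exact: metric_pos.
pose u := (Num.sqrt (form (g x) v v))^-1 *: v.
have gu : form (g x) u u = 1.
  rewrite form_scalel form_scaler mulrA -invfM.
  rewrite -expr2 sqr_sqrtr ?ltW // mulVf //.
  by rewrite gt_eqF.
have hu : pairing h u = 0.
  by rewrite /pairing -scalemxAl mxE [X in _ * X]hv mulr0.
pose f := u *m phi S i x.
have hf : pairing h f = 0 by exact: eta_phi.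
have hX : pairing h X = 1 by exact: eta_xi.
have gf : form (g x) f f = 1.
  by rewrite /f phi_metric // -/h hu mulr0 subr0.
have uf : form (g x) u f = 0 by exact: metric_phi_self.
have gX w : form (g x) w X = pairing h w by exact: metric_xi.
have sym a b : form (g x) a b = form (g x) b a by exact: metric_sym.
exists (fun a => [tuple u; f; X]`_a).
split=> [a b| |a] //.
  case: (ord3P a) => ->; case: (ord3P b) => -> /=;
    by rewrite ?gu ?gf ?gX ?uf ?[form _ f u]sym ?uf
      ?[form _ X _]sym ?gX ?hX ?hu ?hf.
by case: (ord3P a) => -> /=; rewrite ?hX ?hu ?hf.
Qed.

(** * The trichotomy *)

(** The case [beta <> 0] of the theorem, read in one chart. *)
Lemma ricci_operator_cases (R : realType) (M : smooth_manifold R 3)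
    (S : almost_contact_metric M) (Q : endo_field M) (i : chart_index M) x
    (al be : R) :
  is_ricci_operator (metric S) Q -> target (atlas i) x -> be != 0 ->
  (forall e, orthonormal (metric S i) x e -> forall u v,
    breveR (metric S i) x e u v = al * form (metric S i x) u v +
      be * (pairing (eta S i x) u * pairing (eta S i x) v)) ->
  (exists a b, forall u : 'rV[R]_3,
    u *m Q i x = a *: u + (b * pairing (eta S i x) u) *: xi S i x) \/
  xi S i x *m Q i x = 0.
Proof.
move=> ricciQ Ux be0 weak.
have [e [e_on eX he]] := exists_adapted_frame S Ux.
have U_open : open (target (atlas i)) by exact: target_open.
have G_smooth : smooth_on (target (atlas i)) (metric S i).
  exact: comp_smooth.
have G_sym y := @metric_trmx _ _ _ (metric S) i y.
have G_unit y := @metric_unitmx _ _ _ (metric S) i y.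
pose T a b c d := riem (metric S i) x (e a) (e b) (e c) (e d).
have QE p q : form (metric S i x) (e p *m Q i x) (e q) = \sum_c T c p q c.
  by rewrite (ricciQ i x Ux e e_on).
have [| | |||[a [b ab]]|ric0] := @curvature_tensor_cases R T al be.
- by move=> *; exact: riem_antisym12.
- by move=> *; exact: (riem_antisym34 U_open G_smooth G_sym G_unit).
- by move=> *; exact: (riem_pair_sym U_open G_smooth G_sym G_unit).
- by [].
- by move=> p q; rewrite -e_on -!he; exact: weak.
- left; exists a, b => u.
  have -> : Q i x = a%:M + b *: (eta S i x *m xi S i x).
    apply: (frame_spans e_on) => p; apply/eqP; rewrite -subr_eq0; apply/eqP.
    apply: (frame_nondegenerate e_on) => q.
    rewrite mulmxDr mul_mx_scalar -scalemxAr mulmxA.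
    rewrite [e p *m eta S i x]mx11_scalar.
    rewrite mul_scalar_mx -/(pairing _ _).
    rewrite form_addl form_oppl form_addl !form_scalel.
    rewrite QE ab [form _ (xi S i x) _](metric_sym _ Ux) metric_xi // !he e_on.
    by rewrite subrr.
  rewrite mulmxDr mul_mx_scalar -scalemxAr mulmxA [u *m eta S i x]mx11_scalar.
  by rewrite mul_scalar_mx scalerA.
- right; apply: (frame_nondegenerate e_on) => q.
  by rewrite -eX QE ric0.
Qed.

Theorem theorem3p1 (R : realType) (M : smooth_manifold R 3)
    (S : almost_contact_metric M) (Q : endo_field M)
    (ricciQ : is_ricci_operator (metric S) Q)
    (weakS : weakly_eta_einstein S) :
  forall p : M,
    eta_einstein_ricci_at S Q p \/ ricci_xi_eq0_at S Q p \/
    weakly_einstein_at (metric S) p.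
Proof.
move=> p; have [al [be [_ [_ weak]]]] := weakS.
have [be0|be0] := eqVneq (be p) 0.
  right; right => i pi x e e_on u v; have W := weak p i pi e e_on.
  have -> : riem_norm2 (metric S i) x e = 3%:R * al p.
    rewrite riem_norm2_trace (eq_bigr (fun=> al p)) => [|a _].
      by rewrite sumr_const card_ord mulr_natl.
    by rewrite W be0 mul0r addr0 e_on eqxx mulr1.
  by rewrite W be0 mul0r addr0 [3%:R * _]mulrC mulfK // pnatr_eq0.
have [i pi] := atlas_cover p.
have [[a [b ab]]|X0] :=
  ricci_operator_cases ricciQ (coord_target pi) be0 (weak p i pi).
  left; exists a, b => j pj x u.
  apply/eqP; rewrite -subr_eq0; apply/eqP.
  apply: (chart_change_inj (metric S) pj pi).
  rewrite mulmxBl mulmxDl -!scalemxAl -mulmxA.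
  rewrite (comp_change Q pj pi) -(comp_change (xi S) pj pi) mulmxA ab.
  rewrite (comp_change (eta S) pj pi) /pairing mulmxA.
  by rewrite subrr.
right; left => j pj x; apply: (chart_change_inj (metric S) pj pi).
by rewrite -mulmxA (comp_change Q pj pi) mulmxA -(comp_change (xi S) pj pi).
Qed.
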